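(* Let $u(x,t)\in\mathcal{P}$ with $u_3\equiv 0$. Then $P=P(x_1,x_2,t)$ is harmonic in the space variables $x_1$ and $x_2$.
   Context: $\nu,h,\Pi_1,\Pi_2>0$ are constants and $\mathcal{O}=\mathbb{R}\times\mathbb{R}\times[0,h]$. Velocity fields $u=(u_1,u_2,u_3)(x,t)$, $x=(x_1,x_2,x_3)\in\mathcal{O}$, are solutions of the Navier-Stokes equations $\partial_t u+(u\cdot\nabla)u=\nu\Delta u-\nabla P$, $\nabla\cdot u=0$, with no-slip condition $u=0$ at $x_3=0$ and $x_3=h$; here $P=P(x,t)$ is the sum of pressure and a time-independent potential. Such a $u$ belongs to the class $\mathcal{P}$ if: (A.1) $u\in C^\infty(\mathcal{O}\times\mathbb{R})$; (A.2) $u$ is periodic in $x_1$ and $x_2$ with periods $\Pi_1$ and $\Pi_2$; it then follows that $P(x_1+\Pi_1,x_2,x_3,t)-P(x_1,x_2,x_3,t)=:p_1(t)$ and $P(x_1,x_2+\Pi_2,x_3,t)-P(x_1,x_2,x_3,t)=:p_2(t)$ depend only on $t$; (A.3) $u$ exists for all $t\in\mathbb{R}$ and has bounded energy per mass: $\int_0^{\Pi_1}\int_0^{\Pi_2}\int_0^h u\cdot u\,dx<\infty$ for all $t\in\mathbb{R}$; (A.4) there is a constant $\bar p<\infty$ with $0<-p_1(t)\le\bar p$ and $|p_2(t)|\le\bar p$ for all $t\in\mathbb{R}$; (A.5) $\sup_{x_2\in\mathbb{R}}P(x_1,x_2,x_3,t)<\infty$ for all $x_1,x_3,t$. When $u_3\equiv0$,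 the third momentum equation gives $\partial P/\partial x_3=0$, so $P$ is written $P(x_1,x_2,t)$. *)

(* Defs.v *)
From HB Require Import structures.
From mathcomp Require Import all_boot all_order all_algebra.
From mathcomp Require Import all_classical all_reals all_analysis.

Set Implicit Arguments.
Unset Strict Implicit.
Unset Printing Implicit Defensive.

Import Order.TTheory GRing.Theory Num.Theory.
Import numFieldNormedType.Exports.

Local Open Scope classical_set_scope.
Local Open Scope ring_scope.

(* Relative versions of the library's derivable and 'D_v f: only the
   increments staying in D are used. On the walls of the slab this gives the
   one-sided normal derivative, and values of f outside D are irrelevant. *)
Definition derivable_within (R : realType) (V : normedModType R) (D : set V)
    (f : V -> R) (p v : V) : Prop :=
  cvg ((fun s : R => s^-1 *: (f (s *: v + p) - f p))
         @ within [set s : R | D (s *: v + p)] 0^').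

Definition derive_within (R : realType) (V : normedModType R) (D : set V)
    (v : V) (f : V -> R) (p : V) : R :=
  lim ((fun s : R => s^-1 *: (f (s *: v + p) - f p))
         @ within [set s : R | D (s *: v + p)] 0^').

Definition slab (R : realType) (h : R) : set 'rV[R]_3 :=
  [set x | 0 <= x ord0 2 <= h].

Definition slab_time (R : realType) (h : R) : set ('rV[R]_3 * R) :=
  slab h `*` setT.

Definition pt3 (R : realType) (x1 x2 x3 : R) : 'rV[R]_3 :=
  \row_(i < 3) [:: x1; x2; x3]`_i.

Definition pt2 (R : realType) (x1 x2 : R) : 'rV[R]_2 :=
  \row_(i < 2) [:: x1; x2]`_i.

Definition basis_vec (R : realType) (n : nat) (i : 'I_n) : 'rV[R]_n :=
  delta_mx ord0 i.

(* Some i stands for the space variable of index i, None for time. *)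
Definition direction (R : realType) (c : option 'I_3) : 'rV[R]_3 * R :=
  if c is Some i then (basis_vec R i, 0) else (0, 1).

Definition pderiv (R : realType) (h : R) (c : option 'I_3)
    (f : 'rV[R]_3 * R -> R) : 'rV[R]_3 * R -> R :=
  derive_within (slab_time h) (direction R c) f.

Definition has_pderiv (R : realType) (h : R) (c : option 'I_3)
    (f : 'rV[R]_3 * R -> R) : Prop :=
  forall z, slab_time h z ->
    derivable_within (slab_time h) f z (direction R c).

(* C^infinity up to the walls: every iterated partial derivative, in any order
   of differentiation, exists and is continuous on the closed set. *)
Definition smooth (R : realType) (h : R) (f : 'rV[R]_3 * R -> R) : Prop :=
  forall cs : seq (option 'I_3),
    let g := foldr (pderiv h) f cs in
    {within slab_time h, continuous g} /\ forall c, has_pderiv h c g.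

Definition component (R : realType) (u : 'rV[R]_3 * R -> 'rV[R]_3) (i : 'I_3) :
    'rV[R]_3 * R -> R :=
  fun z => u z ord0 i.

Record NavierStokes_noslip (R : realType) (nu h : R)
    (u : 'rV[R]_3 * R -> 'rV[R]_3) (P : 'rV[R]_3 * R -> R) : Prop := {
  pressure_gradient : forall i : 'I_3, has_pderiv h (Some i) P ;
  momentum : forall z, slab_time h z -> forall i : 'I_3,
    pderiv h None (component u i) z
      + \sum_(j < 3) component u j z * pderiv h (Some j) (component u i) z
    = nu * (\sum_(j < 3) pderiv h (Some j) (pderiv h (Some j) (component u i)) z)
      - pderiv h (Some i) P z ;
  incompressible : forall z, slab_time h z ->
    \sum_(i < 3) pderiv h (Some i) (component u i) z = 0 ;
  noslip : forall (x : 'rV[R]_3) (t : R),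
    x ord0 2 = 0 \/ x ord0 2 = h -> u (x, t) = 0
}.

(* The increment of P over one period L in direction i. Since u is periodic,
   so is the gradient of P, and the increment does not depend on the base
   point in the slab, here taken to be the origin. *)
Definition pressure_increment (R : realType) (P : 'rV[R]_3 * R -> R)
    (i : 'I_3) (L t : R) : R :=
  P (L *: basis_vec R i, t) - P (0, t).

(* A velocity field u belongs to the class when classP holds for some P; the
   associated pressure P is a parameter because results are stated about it. *)
Record classP (R : realType) (nu h Pi1 Pi2 : R)
    (u : 'rV[R]_3 * R -> 'rV[R]_3) (P : 'rV[R]_3 * R -> R) : Prop := {
  classP_solution : NavierStokes_noslip nu h u P ;
  classP_smooth : forall i : 'I_3, smooth h (component u i) ;
  classP_periodic : forall (x : 'rV[R]_3) (t : R), slab h x ->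
    u (x + Pi1 *: basis_vec R 0, t) = u (x, t) /\
    u (x + Pi2 *: basis_vec R 1, t) = u (x, t) ;
  classP_energy : forall t : R,
    (\int[lebesgue_measure]_(x1 in `[0%R, Pi1])
      \int[lebesgue_measure]_(x2 in `[0%R, Pi2])
       \int[lebesgue_measure]_(x3 in `[0%R, h])
         (\sum_(i < 3) component u i (pt3 x1 x2 x3, t) ^+ 2)%:E < +oo)%E ;
  classP_increments : exists pbar : R, forall t : R,
    0 < - pressure_increment P 0 Pi1 t <= pbar /\
    `|pressure_increment P 1 Pi2 t| <= pbar ;
  classP_bounded_x2 : forall x1 x3 t : R, 0 <= x3 <= h ->
    (ereal_sup (range (fun x2 : R => (P (pt3 x1 x2 x3, t))%:E)) < +oo)%E
}.

Definition C2 (R : realType) (n : nat) (f : 'rV[R]_n -> R) : Prop :=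
  [/\ continuous f,
      forall i : 'I_n, (forall x, derivable f x (basis_vec R i)) /\
        continuous ('D_(basis_vec R i) f) &
      forall i j : 'I_n,
        (forall x, derivable ('D_(basis_vec R i) f) x (basis_vec R j)) /\
        continuous ('D_(basis_vec R j) ('D_(basis_vec R i) f))].

Definition harmonic_fun (R : realType) (n : nat) (f : 'rV[R]_n -> R) : Prop :=
  C2 f /\
  forall x, \sum_(i < n) 'D_(basis_vec R i) ('D_(basis_vec R i) f) x = 0.

(* Main.v *)
(* On the wall x3 = 0 the velocity and its horizontal and time derivatives
   vanish, so the momentum equation reduces there to dP/dx_i = nu d33 u_i for
   i = 1, 2. Since u_3 = 0, incompressibility reads d1 u_1 + d2 u_2 = 0 in the
   whole slab; applying d33 gives d11 P + d22 P = nu d33 (d1 u_1 + d2 u_2) = 0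
   on the wall. The third momentum equation makes P independent of x3, so this
   is harmonicity everywhere. *)
Require Import Defs.
From HB Require Import structures.
From mathcomp Require Import all_boot all_order all_algebra.
From mathcomp Require Import all_classical all_reals all_analysis.
From mathcomp Require Import ring lra.

Set Implicit Arguments.
Unset Strict Implicit.
Unset Printing Implicit Defensive.

Import Order.TTheory GRing.Theory Num.Theory.
Import numFieldNormedType.Exports.

Local Open Scope classical_set_scope.
Local Open Scope ring_scope.

(** * One-variable calculus along lines and symmetry of mixed derivatives *)

(** Both difference quotients coincide, because [(k + a) *: v + p = k *: v + (a *: v + p)]. This
    makes the mean value theorem available for directional derivatives. *)
Lemma is_derive_line (R : realType) (V : normedModType R) (f : V -> R)
    (v p : V) (a l : R) :
  is_derive (a *: v + p) v f l -> is_derive a 1 (fun s : R => f (s *: v + p)) l.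
Proof.
move=> [df dfl].
have e : (fun k : R => k^-1 *: (f ((k *: (1 : R) + a) *: v + p) - f (a *: v + p)))
       = (fun k : R => k^-1 *: (f (k *: v + (a *: v + p)) - f (a *: v + p))).
  by apply/funext => k; rewrite [k *: (1 : R)]mulr1 scalerDl addrA.
by split; rewrite /derivable /derive/= /shift/= e.
Qed.

Lemma is_derive_continuous (R : realType) (f : R -> R) (x l : R) :
  is_derive x 1 f l -> {for x, continuous f}.
Proof. by move=> [df _]; apply/differentiable_continuous/derivable1_diffP. Qed.

Lemma MVT_is_derive (R : realType) (f df : R -> R) (a b : R) : a < b ->
  (forall x, x \in `[a, b] -> is_derive x 1 f (df x)) ->
  exists2 c, c \in `]a, b[ & f b - f a = df c * (b - a).
Proof.
move=> ab hf.
have cf : {within `[a, b], continuous f}.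
  by apply: derivable_within_continuous => x /hf [].
exact: (MVT ab (fun x xab => hf x (subset_itv_oo_cc xab)) cf).
Qed.

(** The mean value theorem is applied twice: to [F x s - F x 0] as a function of [x], then to [Fx x]
    as a function of its second argument. *)
Lemma second_difference (R : realType) (F Fx Fxy : R -> R -> R) (s : R) :
  0 < s ->
  (forall x y, x \in `[0, s] -> y \in `[0, s] ->
    is_derive x 1 (F^~ y) (Fx x y)) ->
  (forall x y, x \in `[0, s] -> y \in `[0, s] ->
    is_derive y 1 (Fx x) (Fxy x y)) ->
  exists x y, [/\ x \in `]0, s[, y \in `]0, s[ &
    F s s - F s 0 - F 0 s + F 0 0 = Fxy x y * (s * s)].
Proof.
move=> s0 hF hFx.
have m0 : (0 : R) \in `[0, s] by rewrite in_itv/= lexx ltW.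
have ms : s \in `[0, s] by rewrite in_itv/= lexx ltW.
have [|x xs ex] := @MVT_is_derive R (fun x => F x s - F x 0)
    (fun x => Fx x s - Fx x 0) 0 s s0.
  by move=> x xs; apply: is_deriveB; exact: hF.
have [|y ys ey] := @MVT_is_derive R (Fx x) (Fxy x) 0 s s0.
  by move=> y ys; apply: hFx => //; exact: subset_itv_oo_cc.
exists x, y; split => //.
move: ex; rewrite ey !subr0 mulrA => <-; ring.
Qed.

(* Both mixed derivatives are the limit of the second difference of [f] over
   small squares spanned by [v] and [w], divided by their area. *)
Lemma mixed_derivatives_commute (R : realType) (V : normedModType R)
    (f fv fw fvw fwv : V -> R) (v w p : V) :
  (\forall q \near p, [/\ is_derive q v f (fv q), is_derive q w f (fw q),
     is_derive q w fv (fvw q) & is_derive q v fw (fwv q)]) ->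
  {for p, continuous fvw} -> {for p, continuous fwv} -> fvw p = fwv p.
Proof.
move=> hder cvw cwv.
apply/eqP; rewrite -subr_eq0 -normr_le0; apply/ler_addgt0Pl => e e0; rewrite addr0.
pose T (r : R * R) : V := r.1 *: v + (r.2 *: w + p).
have T0 : T 0 = p by rewrite /T/= !scale0r !add0r.
have cT : {for 0, continuous T}.
  apply: cvgD; first by apply: cvgZr_tmp; exact: cvg_fst.
  by apply: cvgD; [apply: cvgZr_tmp; exact: cvg_snd|exact: cvg_cst].
have e20 : 0 < e / 2 by rewrite divr_gt0.
have hn : \forall r \near (0 : R * R),
    [/\ is_derive (T r) v f (fv (T r)), is_derive (T r) w f (fw (T r)),
     is_derive (T r) w fv (fvw (T r)) & is_derive (T r) v fw (fwv (T r))] /\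
    (`|fvw p - fvw (T r)| < e / 2 /\ `|fwv p - fwv (T r)| < e / 2).
  apply: (cT (fun q => [/\ is_derive q v f (fv q), is_derive q w f (fw q),
     is_derive q w fv (fvw q) & is_derive q v fw (fwv q)] /\
    (`|fvw p - fvw q| < e / 2 /\ `|fwv p - fwv q| < e / 2))).
  rewrite T0; apply: filterI => //; apply: filterI.
    by move/cvgr_dist_lt: cvw; apply.
  by move/cvgr_dist_lt: cwv; apply.
have [r /= r0 hr] := (nbhs_ballP _ _).1 hn.
pose s := r / 2.
have s0 : 0 < s by rewrite divr_gt0.
have hs x y : x \in `[0, s] -> y \in `[0, s] -> ball (0 : R * R) r (x, y).
  rewrite !in_itv/= => /andP[x0 xs] /andP[y0 ys].
  have sr : s < r by rewrite /s; lra.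
  by split; rewrite /ball/= sub0r normrN ger0_norm//; lra.
have [||x [y [xs ys exy]]] := @second_difference R (fun x y => f (T (x, y)))
    (fun x y => fv (T (x, y))) (fun x y => fvw (T (x, y))) s s0.
- move=> x y xs ys; have [[h _ _ _] _] := hr _ (hs _ _ xs ys).
  exact: is_derive_line h.
- move=> x y xs ys.
  have -> : (fun y => fv (T (x, y))) = (fun y => fv (y *: w + (x *: v + p))).
    by apply/funext => k; rewrite /T/= addrCA.
  apply: is_derive_line; rewrite addrCA.
  by have [[? ? ? ?] _] := hr _ (hs _ _ xs ys).
(* The same second difference, now differentiated along [w] first. The two intermediate points may
   differ, but both lie in the small square, where each mixed derivative is within [e / 2] of its
   value at [p]. *)
have [||y' [x' [ys' xs' exy']]] := @second_difference R (fun y x => f (T (x, y)))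
    (fun y x => fw (T (x, y))) (fun y x => fwv (T (x, y))) s s0.
- move=> y' x' xs' ys'.
  have -> : (fun y => f (T (x', y))) = (fun y => f (y *: w + (x' *: v + p))).
    by apply/funext => k; rewrite /T/= addrCA.
  apply: is_derive_line; rewrite addrCA.
  by have [[? ? ? ?] _] := hr _ (hs _ _ ys' xs').
- move=> y' x' xs' ys'; have [[_ _ _ h] _] := hr _ (hs _ _ ys' xs').
  exact: is_derive_line h.
have eq : fvw (T (x, y)) = fwv (T (x', y')).
  apply: (@mulIf _ (s * s)); first by rewrite mulf_neq0 ?gt_eqF.
  by rewrite -exy -exy'; ring.
have [_ [h1 _]] := hr _ (hs _ _ (subset_itv_oo_cc xs) (subset_itv_oo_cc ys)).
have [_ [_ h2]] := hr _ (hs _ _ (subset_itv_oo_cc xs') (subset_itv_oo_cc ys')).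
rewrite (_ : _ - _ = (fvw p - fvw (T (x, y))) - (fwv p - fwv (T (x', y')))); last first.
  by rewrite eq; ring.
by rewrite (le_trans (ler_normB _ _))// (splitr e) lerD// ltW.
Qed.

(** * Continuity in the plane from continuous partial derivatives *)

Lemma mean_value_bound (R : realType) (f df : R -> R) (a M : R) :
  (forall x : R, is_derive x 1 f (df x)) ->
  (forall x : R, `|x| <= `|a| -> `|df x| <= M) ->
  `|f a - f 0| <= M * `|a|.
Proof.
move=> hf hM; have [a0|a0|->] := ltgtP a 0; last by rewrite subrr !normr0 mulr0.
  have [c ca e] := MVT_is_derive a0 (fun x _ => hf x).
  rewrite distrC e sub0r normrM normrN ler_wpM2r// hM//.
  by move: ca; rewrite in_itv/= => /andP[? ?]; rewrite !ltr0_norm//; lra.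
have [c ca e] := MVT_is_derive a0 (fun x _ => hf x).
rewrite e subr0 normrM ler_wpM2r// hM//.
by move: ca; rewrite in_itv/= => /andP[? ?]; rewrite !gtr0_norm//; lra.
Qed.

Lemma ord2_case (i : 'I_2) : i = 0 \/ i = 1.
Proof. by case: i => [[|[|//]] i2]; [left|right]; exact: val_inj. Qed.

(** The path from [y] to [w] runs first along [e0], then along [e1]. The first leg is controlled by
    continuity on a single line through [y], the second by the mean value theorem and a local bound
    on the [e1] derivative. *)
Lemma continuous_of_partials (R : realType) (f : 'rV[R]_2 -> R) :
  (forall i x, derivable f x (basis_vec R i)) ->
  (forall i, continuous ('D_(basis_vec R i) f)) -> continuous f.
Proof.
move=> df cdf y.
pose e0 := basis_vec R (0 : 'I_2); pose e1 := basis_vec R (1 : 'I_2).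
(* The corner of the path: first coordinate of [w], second coordinate of [y]. *)
pose m (w : 'rV[R]_2) : 'rV[R]_2 := (w ord0 0 - y ord0 0) *: e0 + y.
have wm (w : 'rV[R]_2) : w = (w ord0 1 - y ord0 1) *: e1 + m w.
  by apply/rowP => i; case: (ord2_case i) => ->; rewrite !mxE/=; ring.
have cm : {for y, continuous (fun w => f (m w))}.
  have e : (fun w => f (m w)) =
      (fun s : R => f (s *: e0 + y)) \o (fun w : 'rV[R]_2 => w ord0 0 - y ord0 0).
    by [].
  rewrite e; apply: continuous_comp.
    exact: (cvgB (@coord_continuous R 1 2 ord0 0 y) (cvg_cst _)).
  apply: (@is_derive_continuous _ _ _ ('D_e0 f y)).
  apply: is_derive_line; rewrite subrr scale0r add0r.
  exact/derivableP/df.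
have my : m y = y by rewrite /m subrr scale0r add0r.
pose M := `|'D_e1 f y| + 1.
have M0 : 0 < M by rewrite /M ltr_wpDl.
have nM : \forall w \near y, `|'D_e1 f w| < M.
  by have := cvgr_norm_lt _ (cdf 1 y); apply; rewrite ltrDl.
have [r /= r0 hr] := (nbhs_ballP _ _).1 nM.
apply/(@cvgrPdist_le _ _ _ (nbhs y)) => e e_gt0.
have e20 : 0 < e / 2 by rewrite divr_gt0.
near=> w.
have bw : ball y r w by near: w; exact: nbhsx_ballx.
have w1 : M * `|w ord0 1 - y ord0 1| <= e / 2.
  rewrite -ler_pdivlMl// distrC; near: w.
  have /cvgrPdist_le := @coord_continuous R 1 2 ord0 1 y; apply.
  by rewrite mulr_gt0// invr_gt0.
have w2 : `|f (m w) - f y| <= e / 2.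
  rewrite distrC -[f y](congr1 f my); near: w.
  by move/cvgrPdist_le: cm; apply.
rewrite distrC (splitr e).
rewrite (_ : f w - f y = (f w - f (m w)) + (f (m w) - f y)); last by ring.
apply: (le_trans (ler_normD _ _)); apply: lerD => //; apply: le_trans w1.
have := @mean_value_bound R (fun s => f (s *: e1 + m w))
  (fun s => 'D_e1 f (s *: e1 + m w)) (w ord0 1 - y ord0 1) M.
rewrite -wm scale0r add0r; apply.
  by move=> s; apply: is_derive_line; exact/derivableP/df.
(* In the maximum norm the second leg stays as close to [y] as [w] is, so the bound [M] holds along
   it. *)
move=> s sw; apply/ltW/hr.
split=> // i j; rewrite ord1; case: bw => _ bw.
have := bw 0 j; have := bw 0 1; rewrite /ball/=.
case: (ord2_case j) => -> b1 b2; rewrite !mxE/= ?mulr0 ?mulr1 ?add0r ?subrK//.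
by rewrite opprD addrCA subrr addr0 normrN (le_lt_trans sw)// distrC.
Unshelve. all: by end_near. Qed.

(** * The lower wall and its parametrization by the plane *)

Lemma pt3E (R : realType) (x1 x2 x3 : R) :
  pt3 x1 x2 x3 = x1 *: basis_vec R 0 + x2 *: basis_vec R 1 + x3 *: basis_vec R 2.
Proof.
by apply/rowP => -[[|[|[|//]]] i3]; rewrite !mxE/=; ring.
Qed.

Definition wall (R : realType) (t : R) (y : 'rV[R]_2) : 'rV[R]_3 * R :=
  (pt3 (y ord0 0) (y ord0 1) 0, t).

Definition horizontal (i : 'I_2) : 'I_3 := widen_ord (leqnSn 2) i.

Lemma wall_slab (R : realType) (h t : R) (y : 'rV[R]_2) : 0 < h ->
  slab_time h (wall t y).
Proof. by move=> h0; split => //=; rewrite /slab/= !mxE/= lexx ltW. Qed.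

Lemma wall_shift (R : realType) (t s : R) (i : 'I_2) (y : 'rV[R]_2) :
  s *: direction R (Some (horizontal i)) + wall t y
  = wall t (s *: basis_vec R i + y).
Proof.
congr (_, _) => /=; last by rewrite scaler0 add0r.
apply/rowP => -[[|[|[|//]]] i3]; case: (ord2_case i) => ->; rewrite !mxE/= ?mxE/=; ring.
Qed.

Lemma wall_continuous (R : realType) (t : R) : continuous (@wall R t).
Proof.
move=> y.
have h i : (fun z : 'rV[R]_2 => z ord0 i *: basis_vec R (horizontal i)) @ y -->
    y ord0 i *: basis_vec R (horizontal i).
  exact: (cvgZr_tmp (@coord_continuous R 1 2 ord0 i y)).
pose k (z : 'rV[R]_2) : 'rV[R]_3 := pt3 (z ord0 0) (z ord0 1) 0.
have c : k z @[z --> y] --> k y.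
  have -> : k = (fun z : 'rV[R]_2 => z ord0 0 *: basis_vec R (horizontal 0)
      + z ord0 1 *: basis_vec R (horizontal 1)).
    apply/funext => z; rewrite /k pt3E scale0r addr0.
    by congr (_ *: basis_vec R _ + _ *: basis_vec R _); exact: val_inj.
  exact: (cvgD (h 0) (h 1)).
exact: (cvg_pair c (cvg_cst t)).
Qed.

(** * Relative derivatives compared with ordinary ones *)

Lemma within_full (T : Type) (F : set_system T) (D : set T) :
  Filter F -> F D -> within D F = F.
Proof.
move=> FF FD; apply/seteqP; split => A; rewrite /within /=.
  by move=> h; apply: filterS2 h FD => x; apply.
by apply: filterS.
Qed.

(** The restriction is void once all small increments stay in [D]. This covers every direction at
    interior points, and horizontal and time directions on the wall. *)
Lemma derive_withinE (R : realType) (V : normedModType R) (D : set V)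
    (f : V -> R) (p v : V) : (\forall s \near (0 : R)^', D (s *: v + p)) ->
  derive_within D v f p = 'D_v f p.
Proof. by move=> nD; rewrite /derive_within within_full. Qed.

Lemma derivable_within_derivable (R : realType) (V : normedModType R) (D : set V)
    (f : V -> R) (p v : V) : (\forall s \near (0 : R)^', D (s *: v + p)) ->
  derivable_within D f p v -> derivable f p v.
Proof. by move=> nD; rewrite /derivable_within within_full. Qed.

Lemma eq_fmap_within (T U : Type) (F : set_system T) (D : set T) (f g : T -> U) :
  Filter F -> (forall x, D x -> f x = g x) -> f @ within D F = g @ within D F.
Proof.
move=> FF fg; apply/seteqP; split => A.
  change (F [set x | D x -> A (f x)] -> F [set x | D x -> A (g x)]).
  by apply: filterS => x /= Af Dx; rewrite -fg//; exact: Af.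
change (F [set x | D x -> A (g x)] -> F [set x | D x -> A (f x)]).
by apply: filterS => x /= Ag Dx; rewrite fg//; exact: Ag.
Qed.

Lemma derive_within_congr (R : realType) (V : normedModType R) (D : set V)
    (f g : V -> R) (p v : V) : (forall q, D q -> f q = g q) -> D p ->
  derive_within D v f p = derive_within D v g p.
Proof.
move=> fg Dp; congr lim; apply: eq_fmap_within => s Ds.
by rewrite !fg.
Qed.

(** * Interior of the slab and extension to the walls by continuity *)

Definition open_slab (R : realType) (h : R) : set ('rV[R]_3 * R) :=
  [set z : 'rV[R]_3 * R | 0 < z.1 ord0 2 < h].

Lemma open_slab_sub (R : realType) (h : R) : @open_slab R h `<=` slab_time h.
Proof.
by move=> z /andP[a b]; split => //; rewrite /slab/= !ltW.
Qed.

Lemma open_slab_near (R : realType) (h : R) (z : 'rV[R]_3 * R) :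
  open_slab h z -> \forall z' \near z, open_slab h z'.
Proof.
move=> hz.
pose x3 (w : 'rV[R]_3 * R) : R := w.1 ord0 2.
have c : {for z, continuous x3}.
  apply: (@continuous_comp _ _ _ fst (fun x : 'rV[R]_3 => x ord0 2)).
    exact: cvg_fst.
  exact: coord_continuous.
have zi : x3 z \in `]0, h[ by rewrite in_itv.
have nz : \forall w \near z, x3 w \in `]0, h[ := c _ (near_in_itvoo zi).
near=> w; have : x3 w \in `]0, h[ by near: w.
by rewrite in_itv.
Unshelve. all: by end_near. Qed.

Lemma line_continuous (R : realType) (V : normedModType R) (v p : V) (a : R) :
  {for a, continuous (fun s : R => s *: v + p)}.
Proof. by apply: cvgD; [apply: cvgZr_tmp; exact: cvg_id|exact: cvg_cst]. Qed.

Lemma open_slab_line (R : realType) (h : R) (z v : 'rV[R]_3 * R) :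
  open_slab h z -> \forall s \near (0 : R)^', slab_time h (s *: v + z).
Proof.
move=> hz; apply: (@nbhs_dnbhs R 0).
have := @line_continuous R _ v z 0 (open_slab h).
rewrite scale0r add0r => /(_ (open_slab_near hz)).
by apply: filterS => s; exact: open_slab_sub.
Qed.

Lemma pderiv_is_derive (R : realType) (h : R) c (f : 'rV[R]_3 * R -> R) z :
  has_pderiv h c f -> open_slab h z ->
  is_derive z (direction R c) f (pderiv h c f z).
Proof.
move=> df hz; have nz := open_slab_line (direction R c) hz.
rewrite /pderiv (derive_withinE _ nz).
by apply/derivableP/(derivable_within_derivable nz)/df/open_slab_sub.
Qed.

(** In [foldr] the last entry of the list acts first, so differentiating [f] beforehand amounts to
    appending [c] to the list. *)
Lemma smooth_pderiv (R : realType) (h : R) c (f : 'rV[R]_3 * R -> R) :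
  smooth h f -> smooth h (pderiv h c f).
Proof. by move=> sf cs; have := sf (rcons cs c); rewrite foldr_rcons. Qed.

Lemma smooth_continuous (R : realType) (h : R) (f : 'rV[R]_3 * R -> R) :
  smooth h f -> {within slab_time h, continuous f}.
Proof. by move=> /(_ [::]) []. Qed.

Lemma smooth_has_pderiv (R : realType) (h : R) c (f : 'rV[R]_3 * R -> R) :
  smooth h f -> has_pderiv h c f.
Proof. by move=> /(_ [::]) []. Qed.

(** Relative continuity is transported along any map that eventually stays in [D]: vertical
    segments, the identity near an interior point, the wall parametrization. *)
Lemma within_continuous_cvg (R : realType) (T : Type) (F : set_system T)
    (V : topologicalType) (D : set V) (f : V -> R) (g : T -> V) (p : V) :
  Filter F -> {within D, continuous f} -> D p -> g @ F --> p ->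
  (\forall x \near F, D (g x)) -> f (g x) @[x --> F] --> f p.
Proof.
move=> FF /subspace_continuousP cf Dp gp gD A /(cf p Dp) /= Af.
have := gp _ Af; rewrite /nbhs/= => h.
by apply: filterS2 h gD => x; apply.
Qed.

(* Each point of the slab is approached from inside along the vertical segment
   towards mid-height. *)
Lemma eq_on_slab (R : realType) (h : R) (f g : 'rV[R]_3 * R -> R) : 0 < h ->
  {within slab_time h, continuous f} -> {within slab_time h, continuous g} ->
  (forall z, open_slab h z -> f z = g z) ->
  forall z, slab_time h z -> f z = g z.
Proof.
move=> h0 cf cg fg z hz.
pose d := (h / 2 - z.1 ord0 2) *: direction R (Some 2).
have dz : s *: d + z @[s --> (0 : R)^'+] --> z.
  apply: cvg_at_right_filter.
  by have := @line_continuous R _ d z 0; rewrite /prop_for /continuous_at/= scale0r add0r.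
have od : \forall s \near (0 : R)^'+, open_slab h (s *: d + z).
  near=> s.
  have s0 : 0 < s by [].
  have s1 : s < 1 by near: s; apply: nbhs_right_lt.
  case: hz => /= /andP[z0 zh] _; rewrite /open_slab/= !mxE/= mulr1.
  (* With [x3] the height of [z], the new height is [(1 - s) * x3 + s * (h / 2)], strictly between
     [0] and [h] for [0 < s < 1]. *)
  by apply/andP; split; nra.
have sd : \forall s \near (0 : R)^'+, slab_time h (s *: d + z).
  by apply: filterS od => s; exact: open_slab_sub.
have Hf : f (s *: d + z) @[s --> (0 : R)^'+] --> f z.
  exact: within_continuous_cvg cf hz dz sd.
have Hg : g (s *: d + z) @[s --> (0 : R)^'+] --> g z.
  exact: within_continuous_cvg cg hz dz sd.
have Hgf : f (s *: d + z) @[s --> (0 : R)^'+] --> g z.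
  apply: cvg_trans Hg; apply: near_eq_cvg; near=> s.
  by rewrite fg//; near: s.
exact: (norm_cvg_unique Hf Hgf).
Unshelve. all: by end_near. Qed.

(** * Rules for partial derivatives on the closed slab *)

(** At interior points the derivatives are ordinary ones and the mixed ones are continuous, hence
    equal. Both sides are continuous up to the walls, so the equality extends there. *)
Lemma pderiv_commute (R : realType) (h : R) c d (f : 'rV[R]_3 * R -> R) z :
  0 < h -> smooth h f -> slab_time h z ->
  pderiv h c (pderiv h d f) z = pderiv h d (pderiv h c f) z.
Proof.
move=> h0 sf; move: z.
have sc := smooth_pderiv c sf; have sd := smooth_pderiv d sf.
have scd := smooth_continuous (smooth_pderiv d sc).
have sdc := smooth_continuous (smooth_pderiv c sd).
apply: (eq_on_slab h0 sdc scd) => z hz.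
have nz := open_slab_near hz.
(* Near an interior point all points belong to the slab, so relative continuity is ordinary
   continuity. *)
have cont (g : 'rV[R]_3 * R -> R) :
    {within slab_time h, continuous g} -> {for z, continuous g}.
  move=> cg; have sz : \forall w \near z, slab_time h (id w).
    by apply: filterS nz => w; exact: open_slab_sub.
  exact: (@within_continuous_cvg _ _ (nbhs z) _ _ g id z _ cg (open_slab_sub hz)
    (@cvg_id _ _) sz).
apply: (@mixed_derivatives_commute _ _ f (pderiv h d f) (pderiv h c f) _ _
   (direction R d) (direction R c) z _ (cont _ sdc) (cont _ scd)).
near=> q.
have hq : open_slab h q by near: q.
by split; apply: pderiv_is_derive hq; apply: smooth_has_pderiv.
Unshelve. all: by end_near. Qed.

Lemma pderiv_congr (R : realType) (h : R) c (f g : 'rV[R]_3 * R -> R) z :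
  (forall w, slab_time h w -> f w = g w) -> slab_time h z ->
  pderiv h c f z = pderiv h c g z.
Proof. exact: derive_within_congr. Qed.

(** Linearity of the ordinary derivative in the interior, then continuity up to the walls. The case
    [a = 0] differentiates a vanishing function, the case [a = -1] a divergence relation. *)
Lemma pderiv_proportional (R : realType) (h : R) c a
    (f g : 'rV[R]_3 * R -> R) : 0 < h -> smooth h f -> smooth h g ->
  (forall z, slab_time h z -> f z = a * g z) ->
  forall z, slab_time h z -> pderiv h c f z = a * pderiv h c g z.
Proof.
move=> h0 sf sg fg.
have cf := smooth_continuous (smooth_pderiv c sf).
have cg := smooth_continuous (smooth_pderiv c sg).
have cag : {within slab_time h, continuous (fun z => a * pderiv h c g z)}.
  by move=> x; apply: cvgM; [exact: cvg_cst|exact: cg].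
apply: (eq_on_slab h0 cf cag) => z hz.
have sz := open_slab_sub hz.
have dg := pderiv_is_derive (smooth_has_pderiv (c := c) sg) hz.
rewrite (pderiv_congr c fg sz) /pderiv derive_withinE; last exact: open_slab_line.
have -> : (fun w => a * g w) = a *: g by [].
rewrite deriveZ; last by case: dg.
by case: dg => _ ->.
Qed.

Lemma pderiv_vanishing (R : realType) (h : R) c (f : 'rV[R]_3 * R -> R) :
  0 < h -> smooth h f -> (forall z, slab_time h z -> f z = 0) ->
  forall z, slab_time h z -> pderiv h c f z = 0.
Proof.
move=> h0 sf f0 z hz.
rewrite (pderiv_proportional (a := 0) (g := f) c h0 sf sf) ?mul0r// => w hw.
by rewrite mul0r f0.
Qed.

(** The direction [e] commutes with [c] and [d], so the claim is the given relation, read as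
    [pderiv h c f = -1 * pderiv h d g], differentiated along [e]. *)
Lemma pderiv_divergence (R : realType) (h : R) c d e (f g : 'rV[R]_3 * R -> R) :
  0 < h -> smooth h f -> smooth h g ->
  (forall z, slab_time h z -> pderiv h c f z + pderiv h d g z = 0) ->
  forall z, slab_time h z ->
    pderiv h c (pderiv h e f) z + pderiv h d (pderiv h e g) z = 0.
Proof.
move=> h0 sf sg fg z hz.
have cf_dg w : slab_time h w -> pderiv h c f w = -1 * pderiv h d g w.
  by move=> /fg /eqP; rewrite addr_eq0 mulN1r => /eqP.
have scf := smooth_pderiv c sf; have sdg := smooth_pderiv d sg.
rewrite (pderiv_commute c e h0 sf hz) (pderiv_commute d e h0 sg hz).
apply/eqP; rewrite addr_eq0 -mulN1r; apply/eqP.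
exact: (pderiv_proportional e h0 scf sdg cf_dg hz).
Qed.

(** * Derivatives and continuity along the wall *)

Lemma wall_near (R : realType) (h t : R) (i : 'I_2) (y : 'rV[R]_2) : 0 < h ->
  \forall s \near (0 : R)^',
    slab_time h (s *: direction R (Some (horizontal i)) + wall t y).
Proof. by move=> h0; apply: nearW => s; rewrite wall_shift; exact: wall_slab. Qed.

(* Horizontal increments stay on the wall, so the relative derivative is the
   ordinary one along the wall. *)
Lemma is_derive_wall (R : realType) (h t : R) (i : 'I_2) (y : 'rV[R]_2)
    (f : 'rV[R]_3 * R -> R) : 0 < h -> has_pderiv h (Some (horizontal i)) f ->
  is_derive y (basis_vec R i) (fun y => f (wall t y))
    (pderiv h (Some (horizontal i)) f (wall t y)).
Proof.
move=> h0 df.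
have n := wall_near t i y h0.
have dfw := derivable_within_derivable n (df _ (wall_slab t y h0)).
rewrite /pderiv (derive_withinE _ n).
have e : (fun s : R => s^-1 *: (f (wall t (s *: basis_vec R i + y)) - f (wall t y)))
  = (fun s => s^-1 *: (f (s *: direction R (Some (horizontal i)) + wall t y)
                        - f (wall t y))).
  by apply/funext => s; rewrite wall_shift.
by split; rewrite /derivable /derive/= /shift/= e.
Qed.

Lemma pderiv_wall_horizontal (R : realType) (h : R) (i : 'I_2)
    (f : 'rV[R]_3 * R -> R) (t : R) (y : 'rV[R]_2) :
  0 < h -> has_pderiv h (Some (horizontal i)) f ->
  (forall y, f (wall t y) = 0) ->
  pderiv h (Some (horizontal i)) f (wall t y) = 0.
Proof.
move=> h0 df f0; have [_ <-] := is_derive_wall t y h0 df.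
have -> : (fun y => f (wall t y)) = cst 0 by apply/funext.
exact: derive_cst.
Qed.

Lemma pderiv_wall_time (R : realType) (h : R)
    (f : 'rV[R]_3 * R -> R) (t : R) (y : 'rV[R]_2) :
  0 < h -> (forall t, f (wall t y) = 0) ->
  pderiv h None f (wall t y) = 0.
Proof.
move=> h0 f0.
(* A time increment keeps the point on the wall, so the difference quotient only involves values
   that vanish. *)
have e (s : R) : s *: direction R None + wall t y = wall (s + t) y.
  by congr (_, _) => /=; [rewrite scaler0 add0r|rewrite [s *: _]mulr1].
rewrite /pderiv derive_withinE; last first.
  by apply: nearW => s; rewrite e; exact: wall_slab.
rewrite /derive.
have -> : (fun s : R => s^-1 *: ((f \o shift (wall t y)) (s *: direction R None)
    - f (wall t y))) = cst 0.
  by apply/funext => s; rewrite /= e !f0 subrr scaler0.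
exact: lim_cst.
Qed.

Lemma wall_within_continuous (R : realType) (h t : R) (f : 'rV[R]_3 * R -> R) :
  0 < h -> {within slab_time h, continuous f} ->
  continuous (fun y => f (wall t y)).
Proof.
move=> h0 cf y.
have sy : \forall w \near y, slab_time h (wall t w).
  exact: (filterS (fun w _ => wall_slab t w h0) (@filterT _ (nbhs y) _)).
exact: (@within_continuous_cvg R _ (nbhs y) _ _ f (wall t) _ _ cf
  (wall_slab t y h0) (@wall_continuous R t y) sy).
Qed.

(** * Functions without vertical variation *)

(** The increment of [f] is [s] times a convergent difference quotient, hence tends to [0]. *)
Lemma derivable_within_cvg (R : realType) (V : normedModType R) (D : set V)
    (f : V -> R) (p v : V) : derivable_within D f p v ->
  f (s *: v + p) @[s --> within [set s : R | D (s *: v + p)] 0^'] --> f p.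
Proof.
set F := within _ _ => df; have FF : Filter F by exact: within_filter.
have s0 : (s : R) @[s --> F] --> (0 : R).
  move=> A A0.
  have A' : \forall s \near (0:R)^', A s by exact: nbhs_dnbhs A0.
  change ((0:R)^' [set s : R | D (s *: v + p) -> A s]).
  by apply: filterS A' => s As _.
have H : s * (s^-1 *: (f (s *: v + p) - f p)) + f p @[s --> F] --> f p.
  by have := cvgD (cvgM s0 df) (cvg_cst (f p)); rewrite mul0r add0r; apply.
have Fn : \forall s \near F, s != 0.
  exact: (filterS (fun s sn _ => sn) (@nbhs_dnbhs_neq R 0)).
have e : {near F, (fun s => s * (s^-1 *: (f (s *: v + p) - f p)) + f p)
    =1 (fun s => f (s *: v + p))}.
  near=> s; have sn : s != 0 by near: s.
  rewrite (_ : s^-1 *: _ = s^-1 * (f (s *: v + p) - f p))//.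
  by rewrite mulrA divff// mul1r subrK.
exact: cvg_trans (near_eq_cvg e) H.
Unshelve. all: by end_near. Qed.

(** For the pressure only derivatives are given, so its continuity in height up to both walls is
    obtained from the vertical derivative, one-sided at the ends. As [z] has height [0], the
    parameter [s] is the height. *)
Lemma vertical_continuous (R : realType) (h : R) (f : 'rV[R]_3 * R -> R)
    (z : 'rV[R]_3 * R) : z.1 ord0 2 = 0 -> has_pderiv h (Some 2) f ->
  {within `[0, h], continuous (fun s => f (s *: direction R (Some 2) + z))}.
Proof.
move=> z0 df; apply/subspace_continuousP => a /= ha.
set v := direction R (Some 2).
have slabE s : slab_time h (s *: v + z) <-> 0 <= s <= h.
  rewrite /slab_time/slab/= !mxE/= z0 mulr1 addr0; split => [[]//|//].
have sa : slab_time h (a *: v + z) by apply/slabE; move: ha; rewrite in_itv.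
have /cvgrPdist_le c := derivable_within_cvg (df _ sa).
apply/cvgrPdist_le => e e0.
have := c e e0; rewrite /within/= => /nbhs_ballP [r /= r0 hr].
apply/nbhs_ballP; exists r => //= b ab hb.
(* The limit defining the derivative omits the zero increment, so [b = a] is treated apart. *)
have [->|ba] := eqVneq b a; first by rewrite subrr normr0 ltW.
have := hr (b - a); rewrite addrA -scalerDl subrK; apply.
- by move: ab; rewrite /ball/= sub0r normrN distrC.
- by rewrite subr_eq0.
- by apply/slabE; move: hb; rewrite in_itv.
Qed.

(** Mean value theorem on the vertical segment: the derivative is two-sided and zero strictly
    between the walls, and continuity suffices at the ends. *)
Lemma vertical_constant (R : realType) (h t x1 x2 x3 : R)
    (f : 'rV[R]_3 * R -> R) : has_pderiv h (Some 2) f ->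
  (forall z, slab_time h z -> pderiv h (Some 2) f z = 0) -> 0 <= x3 <= h ->
  f (pt3 x1 x2 x3, t) = f (pt3 x1 x2 0, t).
Proof.
move=> df f0 /andP[]; rewrite le_eqVlt => /predU1P[<-//|x30 x3h].
pose z := (pt3 x1 x2 0, t).
have z0 : z.1 ord0 2 = 0 by rewrite /z !mxE.
pose phi s := f (s *: direction R (Some 2) + z).
have cphi : {within `[0, x3], continuous phi}.
  apply: continuous_subspaceW (vertical_continuous z0 df).
  by apply: subset_itvl; rewrite bnd_simp.
have dphi (s : R) : s \in `]0, x3[ -> is_derive s 1 phi ((cst 0 : R -> R) s).
  rewrite in_itv/= => /andP[s0 s3].
  have os : open_slab h (s *: direction R (Some 2) + z).
    by rewrite /open_slab/= !mxE/= mulr1 addr0 s0 (lt_le_trans s3).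
  have := pderiv_is_derive df os; rewrite f0; last exact: open_slab_sub.
  exact: is_derive_line.
have [c _] := MVT x30 dphi cphi.
rewrite mul0r => /eqP; rewrite subr_eq0 => /eqP; rewrite /phi scale0r add0r => <-.
by congr (f (_, _)); rewrite /= ?scaler0 ?add0r// !pt3E scale0r addr0 addrC.
Qed.

(** * Harmonicity of the pressure *)

Lemma sum_ord2 (R : nmodType) (F : 'I_2 -> R) : \sum_(i < 2) F i = F 0 + F 1.
Proof.
by rewrite !big_ord_recr big_ord0 /= add0r; congr (F _ + F _); exact: val_inj.
Qed.

Lemma sum_ord3 (R : nmodType) (F : 'I_3 -> R) :
  \sum_(i < 3) F i = F 0 + F 1 + F 2.
Proof.
rewrite !big_ord_recr big_ord0 /= add0r.
by congr (F _ + F _ + F _); exact: val_inj.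
Qed.

Theorem proposition5p1 (R : realType) (nu h Pi1 Pi2 : R)
    (hnu : 0 < nu) (hh : 0 < h) (hPi1 : 0 < Pi1) (hPi2 : 0 < Pi2)
    (u : 'rV[R]_3 * R -> 'rV[R]_3) (P : 'rV[R]_3 * R -> R)
    (hu : classP nu h Pi1 Pi2 u P)
    (hu3 : forall (x : 'rV[R]_3) (t : R), slab h x -> component u 2 (x, t) = 0) :
  exists Q : 'rV[R]_2 -> R -> R,
    (forall x1 x2 x3 t : R, 0 <= x3 <= h ->
       P (pt3 x1 x2 x3, t) = Q (pt2 x1 x2) t) /\
    (forall t : R, harmonic_fun (fun y : 'rV[R]_2 => Q y t)).
Proof.
have [[hP hmom hdiv hns] hsm _ _ _ _] := hu.
have u2_0 z : slab_time h z -> component u 2 z = 0.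
  by case: z => x t [hx _]; exact: hu3.
have du2_0 c z : slab_time h z -> pderiv h c (component u 2) z = 0.
  by move=> hz; apply: pderiv_vanishing (hsm 2) u2_0 z hz.
have ddu2_0 c d z : slab_time h z ->
    pderiv h c (pderiv h d (component u 2)) z = 0.
  by move=> hz; apply: pderiv_vanishing (smooth_pderiv d (hsm 2)) (du2_0 d) z hz.
have dP2 z : slab_time h z -> pderiv h (Some 2) P z = 0.
  move=> hz; have := hmom z hz 2; rewrite du2_0// !big1 => [||j _]; last 2 first.
  - by move=> j _; rewrite ddu2_0.
  - by rewrite du2_0// mulr0.
  by rewrite mulr0 addr0 sub0r => /eqP; rewrite eq_sym oppr_eq0 => /eqP.
(* The only part of the Laplacian of the velocity that survives on the wall. *)
pose d33 i := pderiv h (Some 2) (pderiv h (Some 2) (component u i)).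
have sd33 i : smooth h (d33 i) by do 2 apply: smooth_pderiv; exact: hsm.
have wall0 i t (y : 'rV[R]_2) : component u i (wall t y) = 0.
  by rewrite /component hns ?mxE//; left.
have wall1 i j t (y : 'rV[R]_2) :
    pderiv h (Some (horizontal j)) (component u i) (wall t y) = 0.
  apply: pderiv_wall_horizontal => //.
  by apply: smooth_has_pderiv; exact: hsm.
have wall2 i j t (y : 'rV[R]_2) : pderiv h (Some (horizontal j))
    (pderiv h (Some (horizontal j)) (component u i)) (wall t y) = 0.
  apply: pderiv_wall_horizontal => //.
  by apply: smooth_has_pderiv; apply: smooth_pderiv; exact: hsm.
have h0 : horizontal 0 = 0 by exact: val_inj.
have h1 : horizontal 1 = 1 by exact: val_inj.
(* The convective sum vanishes through its factors [component u j]; the vertical derivative of the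
   velocity may be nonzero on the wall. *)
have wallP t i (y : 'rV[R]_2) : pderiv h (Some (horizontal i)) P (wall t y)
    = nu * d33 (horizontal i) (wall t y).
  have := hmom _ (wall_slab t y hh) (horizontal i).
  rewrite pderiv_wall_time// big1 => [|j _]; last by rewrite wall0 mul0r.
  rewrite sum_ord3 -h0 -h1 !wall2 !add0r => /eqP.
  by rewrite eq_sym subr_eq0 eq_sym => /eqP.
have divd33 z : slab_time h z ->
    pderiv h (Some 0) (d33 0) z + pderiv h (Some 1) (d33 1) z = 0.
  (* Incompressibility of the two horizontal components is differentiated twice in the vertical
     direction. *)
  move: z; do 2 (apply: (pderiv_divergence _ hh);
    [by do ?apply: smooth_pderiv; exact: hsm..|]).
  by move=> z hz; have := hdiv _ hz; rewrite sum_ord3 du2_0// addr0.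
(* The witness is the pressure on the lower wall, which equals the pressure at every height above
   it. *)
exists (fun y t => P (wall t y)); split.
  move=> x1 x2 x3 t hx3; rewrite (vertical_constant _ _ _ (hP 2) dP2 hx3).
  by congr (P (pt3 _ _ _, _)); rewrite !mxE.
move=> t.
have D1 i y := is_derive_wall t y hh (hP (horizontal i)).
(* The wall identity writes the gradient of the witness through derivatives of the smooth velocity.
   This provides its second derivatives, although only first derivatives of [P] are given. *)
pose G i (y : 'rV[R]_2) : R := nu * d33 (horizontal i) (wall t y).
have D1E i : 'D_(basis_vec R i) (fun y => P (wall t y)) = G i.
  by apply/funext => y; have [_ ->] := D1 i y; rewrite wallP.
have cont_nu (g : 'rV[R]_2 -> R) : continuous g -> continuous (fun y => nu * g y).
  by move=> cg y; exact: (cvgM (cvg_cst nu) (cg y)).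
have cG i : continuous (G i).
  apply: cont_nu.
  exact: wall_within_continuous hh (smooth_continuous (sd33 _)).
have D2 i j y : is_derive y (basis_vec R j) (G i)
    (nu * pderiv h (Some (horizontal j)) (d33 (horizontal i)) (wall t y)).
  apply: is_deriveZ; apply: is_derive_wall => //.
  exact: smooth_has_pderiv (sd33 _).
have D2E i j : 'D_(basis_vec R j) (G i) = (fun y =>
    nu * pderiv h (Some (horizontal j)) (d33 (horizontal i)) (wall t y)).
  by apply/funext => y; have [_ ->] := D2 i j y.
split; last first.
  move=> y /=; rewrite sum_ord2.
  have E i : 'D_(basis_vec R i) ('D_(basis_vec R i) (fun y => P (wall t y))) y =
      nu * pderiv h (Some (horizontal i)) (d33 (horizontal i)) (wall t y).
    by rewrite D1E; have [_ ->] := D2 i i y.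
  (* The Laplacian is [nu] times the horizontal divergence of [d33], which is zero. *)
  rewrite (E 0) (E 1) -mulrDr h0 h1 (divd33 _ (wall_slab t y hh)).
  exact: mulr0.
split.
- apply: continuous_of_partials => i; first by move=> x; have [] := D1 i x.
  by rewrite D1E.
- move=> i; split; first by move=> x; have [] := D1 i x.
  by rewrite D1E.
- move=> i j; rewrite D1E; split; first by move=> x; have [] := D2 i j x.
  rewrite D2E; apply: cont_nu.
  exact: wall_within_continuous hh (smooth_continuous (smooth_pderiv _ (sd33 _))).
Qed.
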